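(* Let $(E,v)$ be a valued field and $(M,w)$ a finite-dimensional valued field extension of $(E,v)$. If $M$ is normal over $E$, then the associated graded field $GM$ is normal over $GE$.
   Context: For a field $E$ with valuation $v$ with values in a totally ordered abelian group $\Gamma$, and $\gamma\in\Gamma$, put $E^{\gamma}=\{x\in E: v(x)\ge\gamma\}$, $E^{>\gamma}=\{x\in E: v(x)>\gamma\}$, $GE_\gamma=E^\gamma/E^{>\gamma}$. For $x\in E\setminus\{0\}$, $\widetilde{x}=x+E^{>v(x)}\in GE_{v(x)}$, and $\widetilde 0=0$. The associated graded field is $GE=\bigoplus_{\gamma}GE_\gamma$ with multiplication determined by $\widetilde{x}\,\widetilde{y}=\widetilde{xy}$. If $(M,w)$ is a valued extension of $(E,v)$, $GM$ contains $GE$ canonically. A graded field is a (nonzero) commutative ring $F=\bigoplus_{\gamma\in\Gamma}F_\gamma$ graded by a totally ordered abelian group $\Gamma$ in which every nonzero homogeneous element is invertible; it is an integral domain. $\Gamma_F=\{\gamma: F_\gamma\neq0\}$. For $\lambda$ in the divisible hull $\Gamma_F\otimes_{\mathbb{Z}}\mathbb{Q}$, $F[X]^{(\lambda)}$ is the polynomial ring $F[X]$ with the unique grading extending that of $F$ and with $X$ homogeneous of grade $\lambda$; a polynomial is homogenizable if it is homogeneous in $F[X]^{(\lambda)}$ for some such $\lambda$. An algebraic graded field extension $L$ of a graded field $F$ is normal over $F$ if every homogenizable irreducible polynomial of $F[X]$ which has a root in $L$ factors into polynomials of degree one in $L[X]$. *)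

(* Defs.v *)
From HB Require Import structures.
From mathcomp Require Import all_boot all_order all_algebra all_field.
From mathcomp Require Import boolp zify.

Set Implicit Arguments.
Unset Strict Implicit.
Unset Printing Implicit Defensive.

Import Order.TTheory GRing.Theory Num.Theory.
Local Open Scope ring_scope.
Local Open Scope quotient_scope.

(* A plain record: an HB structure on top of [Order.Total] and
   [GRing.Zmodule] would clash with [Num.RealDomain] (missing join). *)
Record oagType := OagType {
  oag_sort :> porderZmodType;
  oag_total : total (<=%R : rel oag_sort);
  oag_leD2l : forall z x y : oag_sort, x <= y -> z + x <= z + y
}.

Section OrderedGroupTheory.
Variable G : oagType.
Implicit Types (x y z : G).

Lemma oag_leDl z x y : (z + x <= z + y) = (x <= y).
Proof.
apply/idP/idP; last exact: oag_leD2l.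
by move/(oag_leD2l (- z)); rewrite !addKr.
Qed.

Lemma oag_leDr z x y : (x + z <= y + z) = (x <= y).
Proof. by rewrite ![_ + z]addrC oag_leDl. Qed.

Lemma oag_ltDl z x y : (z + x < z + y) = (x < y).
Proof. by rewrite !lt_neqAle oag_leDl (inj_eq (addrI z)). Qed.

Lemma oag_ltDr z x y : (x + z < y + z) = (x < y).
Proof. by rewrite ![_ + z]addrC oag_ltDl. Qed.

Lemma oag_leD x y z t : x <= y -> z <= t -> x + z <= y + t.
Proof. by move=> xy zt; apply: (@le_trans _ _ (y + z)); rewrite (oag_leDl, oag_leDr). Qed.

Lemma oag_lt_leD x y z t : x < y -> z <= t -> x + z < y + t.
Proof. by move=> xy zt; apply: (@lt_le_trans _ _ (y + z)); rewrite (oag_leDl, oag_ltDr). Qed.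

Lemma oag_mulrn_gt0 x n : 0 < x -> 0 < x *+ n.+1.
Proof.
move=> x0; elim: n => // n IHn; rewrite mulrS.
by rewrite -[ltLHS]addr0; apply: oag_lt_leD => //; apply: ltW.
Qed.

Lemma oag_mulrn_eq0 x n : x *+ n.+1 = 0 -> x = 0.
Proof.
move=> xn0; case: (comparable_ltgtP (oag_total x 0)) => // [x0|/(@oag_mulrn_gt0 _ n)]; last by rewrite xn0 ltxx.
have /(@oag_mulrn_gt0 _ n) : 0 < - x by rewrite -(oag_ltDl x) addr0 subrr.
by rewrite mulNrn xn0 oppr0 ltxx.
Qed.

Lemma oag_mulrnI n : injective (fun x => x *+ n.+1).
Proof.
move=> x y /= exy; apply/eqP; rewrite -subr_eq0; apply/eqP.
by apply: (@oag_mulrn_eq0 _ n); rewrite mulrnBl exy subrr.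
Qed.

End OrderedGroupTheory.

(* The divisible hull: the pair (a, m) represents a / (m + 1). *)

Section DivisibleHull.
Variable G : oagType.
Implicit Types (x y z : G * nat).

Definition dh_eq x y := x.1 *+ y.2.+1 == y.1 *+ x.2.+1.

Lemma dh_eq_equiv : equiv_class_of dh_eq.
Proof.
split=> [x|x y|y x z]; rewrite /dh_eq; [exact: eqxx|exact: eq_sym|].
move=> /eqP xy /eqP yz; apply/eqP; apply: (@oag_mulrnI _ y.2) => /=.
by rewrite mulrnAC xy mulrnAC yz mulrnAC.
Qed.

Canonical dh_eq_equiv_rel := EquivRelPack dh_eq_equiv.
Canonical dh_eq_encModRel := defaultEncModRel dh_eq.

Definition divhull := {eq_quot dh_eq}.
HB.instance Definition _ : EqQuotient _ dh_eq divhull := EqQuotient.on divhull.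
HB.instance Definition _ := Choice.on divhull.

Definition dh_addp x y : G * nat :=
  (x.1 *+ y.2.+1 + y.1 *+ x.2.+1, (x.2.+1 * y.2.+1).-1).
Definition dh_oppp x : G * nat := (- x.1, x.2).

Definition dh_zero : divhull := lift_cst divhull (0, 0%N).
Definition dh_add := lift_op2 divhull dh_addp.
Definition dh_opp := lift_op1 divhull dh_oppp.

Canonical pi_dh_zero_morph := PiConst dh_zero.

Lemma pi_dh_opp : {morph \pi : x / dh_oppp x >-> dh_opp x}.
Proof.
move=> x; unlock dh_opp; apply/eqP; rewrite piE /dh_eq /= !mulNrn eqr_opp.
have /eqP : x = repr (\pi_divhull x) %[mod divhull] by rewrite reprK.
by rewrite piE.
Qed.
Canonical pi_dh_opp_morph := PiMorph1 pi_dh_opp.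

Lemma pi_dh_add : {morph \pi : x y / dh_addp x y >-> dh_add x y}.
Proof.
move=> x y; unlock dh_add; apply/eqP; rewrite piE /dh_eq /=.
have /eqP : x = repr (\pi_divhull x) %[mod divhull] by rewrite reprK.
have /eqP : y = repr (\pi_divhull y) %[mod divhull] by rewrite reprK.
rewrite !piE; case: (repr _) => b' n'; case: (repr _) => a' m'.
case: x y => [a m] [b n]; rewrite /dh_eq /= => /eqP ebn /eqP eam.
rewrite !mulrnDl -!mulrnA; apply/eqP; congr (_ + _).
  rewrite (_ : muln _ _ = m'.+1 * (n.+1 * n'.+1))%N; last lia.
  by rewrite mulrnA eam -mulrnA; congr (_ *+ _); lia.
rewrite (_ : muln _ _ = n'.+1 * (m.+1 * m'.+1))%N; last lia.
by rewrite mulrnA ebn -mulrnA; congr (_ *+ _); lia.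
Qed.
Canonical pi_dh_add_morph := PiMorph2 pi_dh_add.

Lemma dh_addA : associative dh_add.
Proof.
move=> x y z; rewrite -[x]reprK -[y]reprK -[z]reprK !piE; congr \pi.
rewrite /dh_addp /= !mulrnDl -!mulrnA !addrA.
congr (_ + _ + _, _); last lia; congr (_ *+ _); lia.
Qed.

Lemma dh_addC : commutative dh_add.
Proof.
move=> x y; rewrite -[x]reprK -[y]reprK !piE; congr \pi.
by rewrite /dh_addp addrC; congr (_, _.-1); apply: mulnC.
Qed.

Lemma dh_add0 : left_id dh_zero dh_add.
Proof.
move=> x; rewrite -[x]reprK !piE; congr \pi.
by case: (repr x) => a m; rewrite /dh_addp mul0rn add0r mul1n.
Qed.

Lemma dh_addN : left_inverse dh_zero dh_opp dh_add.
Proof.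
move=> x; rewrite -[x]reprK !piE; apply/eqP.
by rewrite piE /dh_eq /= mulNrn addNr !mul0rn.
Qed.

HB.instance Definition _ :=
  GRing.isZmodule.Build divhull dh_addA dh_addC dh_add0 dh_addN.

Definition to_hull (a : G) : divhull := \pi_divhull (a, 0%N).

Lemma to_hullD : {morph to_hull : a b / a + b}.
Proof.
by move=> a b; rewrite /to_hull [RHS]piE; congr \pi.
Qed.

Lemma to_hull_inj : injective to_hull.
Proof. by move=> a b /eqP; rewrite piE /dh_eq => /eqP. Qed.

Lemma hull_mulrn a m n : \pi_divhull (a, m) *+ n = \pi_divhull (a *+ n, m).
Proof.
elim: n => [|n IHn].
  by rewrite mulr0n; apply/eqP; rewrite [0]piE piE /dh_eq /= !mul0rn.
rewrite mulrSr IHn; apply/eqP; rewrite [_ + _]piE piE /dh_eq /=.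
by rewrite -mulrnDl -mulrSr -!mulrnA; apply/eqP; congr (_ *+ _); lia.
Qed.

Lemma hull_torsion (x : divhull) : exists m a, x *+ m.+1 = to_hull a.
Proof.
rewrite -[x]reprK; case: (repr x) => a m; exists m, a.
by rewrite hull_mulrn; apply/eqP; rewrite piE /dh_eq.
Qed.

Lemma hull_div (x : divhull) m : exists y : divhull, y *+ m.+1 = x.
Proof.
rewrite -[x]reprK; case: (repr x) => a k.
exists (\pi_divhull (a, (k.+1 * m.+1).-1)); rewrite hull_mulrn.
by apply/eqP; rewrite piE /dh_eq /= -mulrnA; apply/eqP; congr (_ *+ _); lia.
Qed.

End DivisibleHull.

(* [vfun x] is only meaningful for x != 0; the convention v(0) = oo is built into
   [vge] and [vgt] below. *)
Record valuation (G : oagType) (E : fieldType) := Valuation {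
  vfun :> E -> G;
  valM : forall x y, x != 0 -> y != 0 -> vfun (x * y) = vfun x + vfun y;
  valD : forall x y, x != 0 -> y != 0 -> x + y != 0 ->
    Num.min (vfun x) (vfun y) <= vfun (x + y)
}.

Section Valuation.
Variables (G : oagType) (E : fieldType) (v : valuation G E).
Implicit Types (g d : G) (x y : E).

Lemma val1 : v 1 = 0.
Proof.
by apply: (addrI (v 1)); rewrite -valM ?oner_neq0 // mul1r addr0.
Qed.

Lemma valN x : v (- x) = v x.
Proof.
have [->|x0] := eqVneq x 0; first by rewrite oppr0.
rewrite -mulN1r valM ?oppr_eq0 ?oner_neq0 //.
suff -> : v (- 1) = 0 by rewrite add0r.
apply: (@oag_mulrn_eq0 _ _ 1); rewrite mulr2n -valM ?oppr_eq0 ?oner_neq0 //.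
by rewrite mulrNN mulr1 val1.
Qed.

Definition vge g : {pred E} := fun x => (x == 0) || (g <= v x).
Definition vgt g : {pred E} := fun x => (x == 0) || (g < v x).

Lemma vge_val x : x \in vge (v x).
Proof. by rewrite unfold_in lexx orbT. Qed.

Lemma vgt_vge g x : x \in vgt g -> x \in vge g.
Proof. by rewrite !unfold_in => /orP[->//|/ltW ->]; rewrite orbT. Qed.

Lemma vge_neq0 g x : x \notin vgt g -> x != 0.
Proof. by apply: contraNneq => ->; rewrite unfold_in eqxx. Qed.

Lemma vgtN_val g x : x \in vge g -> x \notin vgt g -> v x = g.
Proof.
rewrite !unfold_in negb_or; case: eqP => //= _ gx /negP ngx.
apply/eqP; apply: contra_notT ngx => vx; rewrite lt_neqAle gx andbT.
by rewrite eq_sym.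
Qed.

Lemma val_leD g x y : x != 0 -> y != 0 -> x + y != 0 ->
  g <= v x -> g <= v y -> g <= v (x + y).
Proof.
move=> x0 y0 xy0 gx gy; apply: le_trans (valD v x0 y0 xy0).
by rewrite minEle; case: ifP.
Qed.

Lemma val_ltD g x y : x != 0 -> y != 0 -> x + y != 0 ->
  g < v x -> g < v y -> g < v (x + y).
Proof.
move=> x0 y0 xy0 gx gy; apply: lt_le_trans (valD v x0 y0 xy0).
by rewrite minEle; case: ifP.
Qed.

Lemma vge_zmod g : zmod_closed (vge g).
Proof.
split=> [|x y]; first by rewrite unfold_in eqxx.
rewrite !unfold_in; have [->|x0] /= := eqVneq x 0.
  by rewrite sub0r oppr_eq0 valN.
have [->|y0] /= := eqVneq y 0; first by rewrite subr0 => ->; rewrite orbT.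
case: eqVneq => //= xy0 gx gy.
by apply: val_leD; rewrite ?oppr_eq0 ?valN.
Qed.

Lemma vgt_zmod g : zmod_closed (vgt g).
Proof.
split=> [|x y]; first by rewrite unfold_in eqxx.
rewrite !unfold_in; have [->|x0] /= := eqVneq x 0.
  by rewrite sub0r oppr_eq0 valN.
have [->|y0] /= := eqVneq y 0; first by rewrite subr0 => ->; rewrite orbT.
case: eqVneq => //= xy0 gx gy.
by apply: val_ltD; rewrite ?oppr_eq0 ?valN.
Qed.

HB.instance Definition _ g := GRing.isZmodClosed.Build E (vge g) (vge_zmod g).
HB.instance Definition _ g := GRing.isZmodClosed.Build E (vgt g) (vgt_zmod g).

Lemma vgeM g d x y : x \in vge g -> y \in vge d -> x * y \in vge (g + d).
Proof.
rewrite !unfold_in mulf_eq0.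
case: (eqVneq x 0) (eqVneq y 0) => [//|x0] [//|y0] /= gx dy.
by rewrite valM // oag_leD.
Qed.

Lemma vgtM g d x y : x \in vgt g -> y \in vge d -> x * y \in vgt (g + d).
Proof.
rewrite !unfold_in mulf_eq0.
case: (eqVneq x 0) (eqVneq y 0) => [//|x0] [//|y0] /= gx dy.
by rewrite valM // oag_lt_leD.
Qed.

Record filt g := Filt { filt_val :> E; filtP : filt_val \in vge g }.

HB.instance Definition _ g := [isSub for @filt_val g].
HB.instance Definition _ g := [Choice of filt g by <:].
HB.instance Definition _ g := [SubChoice_isSubZmodule of filt g by <:].

Definition filt_gt g : {pred filt g} := fun x : filt g => filt_val x \in vgt g.

Lemma filt_gt_zmod g : zmod_closed (@filt_gt g).
Proof.
split=> [|x y gx gy]; rewrite unfold_in; first exact: (rpred0 (vgt g)).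
exact: (rpredB (gx : filt_val x \in vgt g) (gy : filt_val y \in vgt g)).
Qed.

HB.instance Definition _ g :=
  GRing.isZmodClosed.Build (filt g) (@filt_gt g) (filt_gt_zmod g).

(* GE_g = E^g / E^{>g} *)
Definition gr g : Type := {ideal_quot (@filt_gt g)}.
HB.instance Definition _ g := GRing.Zmodule.on (gr g).

(* The class of x in GE_g if x is in E^g, and 0 otherwise. *)
Definition gr_class g (x : E) : gr g := \pi_(gr g) (insubd (0 : filt g) x).

Definition gr_repr g (a : gr g) : E := filt_val (repr a).

Lemma gr_repr_vge g (a : gr g) : gr_repr a \in vge g.
Proof. exact: filtP. Qed.

Lemma gr_reprK g (a : gr g) : gr_class g (gr_repr a) = a.
Proof. by rewrite /gr_class /gr_repr valKd reprK. Qed.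

Lemma gr_class_eq g x y : x \in vge g -> y \in vge g ->
  (gr_class g x == gr_class g y) = (x - y \in vgt g).
Proof.
move=> gx gy; rewrite /gr_class -Quotient.idealrBE unfold_in.
change (\val (insubd (0 : filt g) x) - \val (insubd (0 : filt g) y)
  \in vgt g = (x - y \in vgt g)).
by rewrite !insubdK.
Qed.

Lemma gr_classD g x y : x \in vge g -> y \in vge g ->
  gr_class g (x + y) = gr_class g x + gr_class g y.
Proof.
move=> gx gy; rewrite /gr_class -[RHS]raddfD; congr \pi; apply: val_inj.
change (\val (insubd (0 : filt g) (x + y)) =
  \val (insubd (0 : filt g) x) + \val (insubd (0 : filt g) y)).
by rewrite !insubdK // rpredD.
Qed.

Lemma gr_class0 g : gr_class g 0 = 0.
Proof.
by apply: (addrI (gr_class g 0)); rewrite -gr_classD ?rpred0 // !addr0.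
Qed.

Lemma gr_class_eq0 g x : x \in vge g -> (gr_class g x == 0) = (x \in vgt g).
Proof. by move=> gx; rewrite -(gr_class0 g) gr_class_eq ?rpred0 // subr0. Qed.

Lemma gr_reprB_class g x : x \in vge g -> gr_repr (gr_class g x) - x \in vgt g.
Proof. by move=> gx; rewrite -gr_class_eq ?gr_repr_vge // gr_reprK. Qed.

Lemma gr_reprB g (a : gr g) x : x \in vge g -> gr_class g x = a ->
  gr_repr a - x \in vgt g.
Proof. by move=> gx <-; apply: gr_reprB_class. Qed.

(* The direct sum of the GE_g, as finitely supported families. *)
Record assoc_gr : Type := AssocGr {
  gr_fun :> forall g, gr g;
  gr_fin : exists s : seq G, forall g, gr_fun g != 0 -> g \in s
}.
Implicit Types (f h k : assoc_gr).

HB.instance Definition _ := gen_eqMixin assoc_gr.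
HB.instance Definition _ := gen_choiceMixin assoc_gr.

Lemma assoc_grP f h : (forall g, f g = h g) -> f = h.
Proof.
case: f h => [f f_fin] [h h_fin] /= efh.
have {}efh : f = h by apply: functional_extensionality_dep.
by subst h; congr AssocGr; apply: Prop_irrelevance.
Qed.

Fact assoc_gr0_fin : exists s : seq G, forall g, (0 : gr g) != 0 -> g \in s.
Proof. by exists [::] => g; rewrite eqxx. Qed.
Definition assoc_gr0 := AssocGr assoc_gr0_fin.

Fact assoc_grN_fin f : exists s : seq G, forall g, - f g != 0 -> g \in s.
Proof. by have [s sP] := gr_fin f; exists s => g; rewrite oppr_eq0 => /sP. Qed.
Definition assoc_grN f := AssocGr (assoc_grN_fin f).

Fact assoc_grD_fin f h : exists s : seq G, forall g, f g + h g != 0 -> g \in s.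
Proof.
have [[s sP] [t tP]] := (gr_fin f, gr_fin h); exists (s ++ t) => g.
rewrite mem_cat; have [-> |/sP->//] := eqVneq (f g) 0.
by rewrite add0r => /tP->; rewrite orbT.
Qed.
Definition assoc_grD f h := AssocGr (assoc_grD_fin f h).

Fact assoc_grDA : associative assoc_grD.
Proof. by move=> f h k; apply: assoc_grP => g; apply: addrA. Qed.
Fact assoc_grDC : commutative assoc_grD.
Proof. by move=> f h; apply: assoc_grP => g; apply: addrC. Qed.
Fact assoc_gr0D : left_id assoc_gr0 assoc_grD.
Proof. by move=> f; apply: assoc_grP => g; apply: add0r. Qed.
Fact assoc_grND : left_inverse assoc_gr0 assoc_grN assoc_grD.
Proof. by move=> f; apply: assoc_grP => g; apply: addNr. Qed.

HB.instance Definition _ := GRing.isZmodule.Build assoc_gr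
  assoc_grDA assoc_grDC assoc_gr0D assoc_grND.

Lemma assoc_gr_sumE (I : Type) (s : seq I) (F : I -> assoc_gr) g :
  (\sum_(i <- s) F i) g = \sum_(i <- s) F i g.
Proof. by elim/big_rec2: _ => // i a b _ <-. Qed.

(* The image in the summand GE_g of the class of x in E^g (0 if x is not in
   E^g). *)
Fact gr_hom_fin g x :
  exists s : seq G, forall d, (if d == g then gr_class d x else 0) != 0 -> d \in s.
Proof. by exists [:: g] => d; rewrite inE; case: (d =P g) => //; rewrite eqxx. Qed.
Definition gr_hom g x := AssocGr (gr_hom_fin g x).

(* x + E^{>v(x)} for x != 0; it is 0 for x = 0, whatever [v 0] is. *)
Definition tilde x : assoc_gr := gr_hom (v x) x.

Definition gr_supp f : seq G := undup (sval (cid (gr_fin f))).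

(* The bilinear extension of (x + E^{>b}) (y + E^{>c}) = xy + E^{>b+c}. *)
Definition assoc_grM f h : assoc_gr :=
  \sum_(b <- gr_supp f) \sum_(c <- gr_supp h)
    gr_hom (b + c) (gr_repr (f b) * gr_repr (h c)).

Lemma gr_homE g x : gr_hom g x g = gr_class g x.
Proof. by rewrite /= eqxx. Qed.

Lemma gr_hom_eq0 g x : x \in vgt g -> gr_hom g x = 0.
Proof.
move=> gx; apply: assoc_grP => d /=; case: eqP => // ->.
by apply/eqP; rewrite gr_class_eq0 ?vgt_vge.
Qed.

Lemma gr_homD g x y : x \in vge g -> y \in vge g ->
  gr_hom g (x + y) = gr_hom g x + gr_hom g y.
Proof.
move=> gx gy; apply: assoc_grP => d /=; case: eqP => [->|_].
  exact: gr_classD.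
by rewrite addr0.
Qed.

Lemma gr_hom_eq g x y : x \in vge g -> y \in vge g -> x - y \in vgt g ->
  gr_hom g x = gr_hom g y.
Proof.
move=> gx gy gxy.
by rewrite -[x](subrK y) gr_homD // ?(vgt_vge gxy) // gr_hom_eq0 // add0r.
Qed.

Lemma gr_suppP f g : f g != 0 -> g \in gr_supp f.
Proof. by rewrite mem_undup; case: cid => s sP /= /sP. Qed.

Lemma gr_sum_supp (V : zmodType) f (F : G -> V) (s t : seq G) :
    uniq s -> (forall g, f g != 0 -> g \in s) ->
    uniq t -> (forall g, f g != 0 -> g \in t) ->
    (forall g, f g = 0 -> F g = 0) ->
  \sum_(g <- s) F g = \sum_(g <- t) F g.
Proof.
move=> us fs ut ft F0.
have suppE (r : seq G) :
  \sum_(g <- r) F g = \sum_(g <- [seq g <- r | f g != 0]) F g.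
  rewrite big_filter (bigID (fun g => f g != 0)) /= [X in _ + X]big1 ?addr0 //.
  by move=> g /negPn/eqP/F0.
rewrite suppE [RHS]suppE; apply/perm_big/uniq_perm; rewrite ?filter_uniq // => g.
by rewrite !mem_filter; case: (boolP (f g != 0)) => //= fg; rewrite fs ?ft.
Qed.

Lemma gr_repr_eq0 g (a : gr g) : a = 0 -> gr_repr a \in vgt g.
Proof. by move=> a0; rewrite -gr_class_eq0 ?gr_repr_vge // gr_reprK a0. Qed.

Lemma assoc_gr_expand f (s : seq G) :
    uniq s -> (forall g, f g != 0 -> g \in s) ->
  f = \sum_(g <- s) gr_hom g (gr_repr (f g)).
Proof.
move=> us fs; apply: assoc_grP => g; rewrite assoc_gr_sumE /=.
have [gs|gs] := boolP (g \in s).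
  rewrite (bigD1_seq g) //= eqxx gr_reprK big1 ?addr0 // => d.
  by rewrite eq_sym => /negPf->.
rewrite big_seq big1 => [|d ds]; first by apply/eqP; apply: contraNT gs; apply: fs.
by case: eqP gs => // ->; rewrite ds.
Qed.

Lemma assoc_grME f h (s t : seq G) :
    uniq s -> (forall g, f g != 0 -> g \in s) ->
    uniq t -> (forall g, h g != 0 -> g \in t) ->
  assoc_grM f h = \sum_(b <- s) \sum_(c <- t)
    gr_hom (b + c) (gr_repr (f b) * gr_repr (h c)).
Proof.
move=> us fs ut ht; rewrite /assoc_grM.
rewrite (@gr_sum_supp _ f _ (gr_supp f) s) ?undup_uniq //; first last.
- move=> b fb0; apply: big1 => c _; apply: gr_hom_eq0.
  by apply: vgtM; rewrite ?gr_repr_eq0 ?gr_repr_vge.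
- exact: gr_suppP.
apply: eq_bigr => b _.
apply: (@gr_sum_supp _ h) => //; rewrite ?undup_uniq //; first exact: gr_suppP.
move=> c hc0; apply: gr_hom_eq0; rewrite addrC mulrC.
by apply: vgtM; rewrite ?gr_repr_eq0 ?gr_repr_vge.
Qed.

Lemma assoc_gr_ind (P : assoc_gr -> Prop) :
    P 0 -> (forall f h, P f -> P h -> P (f + h)) ->
    (forall g x, x \in vge g -> P (gr_hom g x)) ->
  forall f, P f.
Proof.
move=> P0 PD Phom f.
rewrite (assoc_gr_expand (undup_uniq _) (@gr_suppP f)).
by elim/big_ind: _ => // g _; apply/Phom/gr_repr_vge.
Qed.

Fact assoc_grMC : commutative assoc_grM.
Proof.
move=> f h; rewrite /assoc_grM exchange_big /=.
by apply: eq_bigr => b _; apply: eq_bigr => c _; rewrite addrC mulrC.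
Qed.

Fact assoc_grMDl : left_distributive assoc_grM +%R.
Proof.
move=> f h k.
pose s := undup (gr_supp f ++ gr_supp h ++ gr_supp (f + h)).
have us : uniq s by apply: undup_uniq.
have fs g : f g != 0 -> g \in s.
  by move/gr_suppP => gs; rewrite (mem_undup (_ ++ _)) !mem_cat gs.
have hs g : h g != 0 -> g \in s.
  by move/gr_suppP => gs; rewrite (mem_undup (_ ++ _)) !mem_cat gs; rewrite orbT.
have fhs g : (f + h) g != 0 -> g \in s.
  by move/gr_suppP => gs; rewrite (mem_undup (_ ++ _)) !mem_cat gs; rewrite !orbT.
have uk : uniq (gr_supp k) by apply: undup_uniq.
rewrite (assoc_grME us fhs uk (@gr_suppP k)).
rewrite (assoc_grME us fs uk (@gr_suppP k)).
rewrite (assoc_grME us hs uk (@gr_suppP k)) -big_split; apply: eq_bigr => b _.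
rewrite -big_split; apply: eq_bigr => c _ /=.
rewrite -gr_homD ?vgeM ?gr_repr_vge // -mulrDl.
have fhb : gr_repr (f b) + gr_repr (h b) \in vge b by rewrite rpredD ?gr_repr_vge.
apply: gr_hom_eq; rewrite ?vgeM ?gr_repr_vge // -mulrBl vgtM ?gr_repr_vge //.
by rewrite gr_reprB // gr_classD ?gr_repr_vge // !gr_reprK.
Qed.

Lemma assoc_gr0M f : assoc_grM 0 f = 0.
Proof. by apply: (addrI (assoc_grM 0 f)); rewrite -assoc_grMDl !addr0. Qed.

Lemma gr_homM b c x y : x \in vge b -> y \in vge c ->
  assoc_grM (gr_hom b x) (gr_hom c y) = gr_hom (b + c) (x * y).
Proof.
have homs g z d : gr_hom g z d != 0 -> d \in [:: g].
  by rewrite /= inE; case: (d =P g) => //; rewrite eqxx.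
move=> bx cy; rewrite (assoc_grME _ (homs b x) _ (homs c y)) // !big_seq1 !gr_homE.
apply: gr_hom_eq; rewrite ?vgeM ?gr_repr_vge //.
set x' := gr_repr _; set y' := gr_repr _.
rewrite -[x' * y'](subrK (x * y')) -addrA -mulrBl -mulrBr rpredD //.
  by rewrite vgtM ?gr_reprB_class ?gr_repr_vge.
by rewrite mulrC [b + c]addrC; apply: vgtM => //; apply: gr_reprB_class.
Qed.

Fact assoc_grMA : associative assoc_grM.
Proof.
have MDr f h k : assoc_grM f (h + k) = assoc_grM f h + assoc_grM f k.
  by rewrite ![assoc_grM f _]assoc_grMC assoc_grMDl.
have M0 f : assoc_grM f 0 = 0 by rewrite assoc_grMC assoc_gr0M.
move=> f h k; elim/assoc_gr_ind: f => [|f1 f2 e1 e2|b x bx].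
- by rewrite !assoc_gr0M.
- by rewrite !assoc_grMDl e1 e2.
elim/assoc_gr_ind: h => [|h1 h2 e1 e2|c y cy].
- by rewrite M0 !assoc_gr0M M0.
- by rewrite !assoc_grMDl !MDr !assoc_grMDl e1 e2.
elim/assoc_gr_ind: k => [|k1 k2 e1 e2|d z dz].
- by rewrite !M0.
- by rewrite !MDr e1 e2.
by rewrite !gr_homM ?vgeM // addrA mulrA.
Qed.

Lemma vge1 : 1 \in vge 0.
Proof. by rewrite -val1 vge_val. Qed.

Fact assoc_gr1M : left_id (gr_hom 0 1) assoc_grM.
Proof.
elim/assoc_gr_ind => [|f h ef eh|b x bx].
- by rewrite assoc_grMC assoc_gr0M.
- by rewrite assoc_grMC assoc_grMDl ![assoc_grM _ (gr_hom 0 1)]assoc_grMC ef eh.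
by rewrite gr_homM ?vge1 // add0r mul1r.
Qed.

Lemma gr_hom_neq0 g x : x \in vge g -> x \notin vgt g -> gr_hom g x != 0.
Proof.
move=> gx; apply: contraNneq => hx0.
by rewrite -gr_class_eq0 // -gr_homE hx0.
Qed.

Fact assoc_gr1_neq0 : gr_hom 0 1 != 0.
Proof.
by apply: gr_hom_neq0; rewrite ?vge1 // unfold_in val1 ltxx oner_eq0.
Qed.

HB.instance Definition _ := GRing.Zmodule_isComNzRing.Build assoc_gr
  assoc_grMA assoc_grMC assoc_gr1M assoc_grMDl assoc_gr1_neq0.

Lemma tildeM x y : tilde x * tilde y = tilde (x * y).
Proof.
have tilde0 : tilde 0 = 0 by apply: gr_hom_eq0; rewrite unfold_in eqxx.
have [->|x0] := eqVneq x 0; first by rewrite mul0r tilde0 mul0r.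
have [->|y0] := eqVneq y 0; first by rewrite mulr0 tilde0 mulr0.
by rewrite [LHS]gr_homM ?vge_val // -valM.
Qed.

End Valuation.

Record gradedField (G : oagType) := GradedField {
  gf_ring :> comNzRingType;
  gf_comp : G -> gf_ring -> Prop;
  gf_comp0 : forall g, gf_comp g 0;
  gf_compB : forall g x y, gf_comp g x -> gf_comp g y -> gf_comp g (x - y);
  gf_comp1 : gf_comp 0 1;
  gf_compM : forall g d x y, gf_comp g x -> gf_comp d y -> gf_comp (g + d) (x * y);
  gf_span : forall x, exists (s : seq G) (c : G -> gf_ring),
    [/\ uniq s, forall g, gf_comp g (c g) & x = \sum_(g <- s) c g];
  gf_indep : forall (s : seq G) (c : G -> gf_ring),
    uniq s -> (forall g, gf_comp g (c g)) -> \sum_(g <- s) c g = 0 ->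
    forall g, g \in s -> c g = 0;
  gf_inv : forall g x, gf_comp g x -> x != 0 -> exists y, x * y = 1
}.

Definition in_grade_set (G : oagType) (F : gradedField G) (g : G) : Prop :=
  exists2 x : F, x != 0 & gf_comp g x.

Record gradedExt (G : oagType) (F L : gradedField G) := GradedExt {
  gext_map :> {rmorphism F -> L};
  gext_inj : injective gext_map;
  gext_comp : forall g x, gf_comp g x -> gf_comp g (gext_map x)
}.

Section Homogenizable.
Variables (G : oagType) (F : gradedField G).
Implicit Types (lambda e : divhull G) (p : {poly F}).

(* The summand of grade e of F, F being graded by the divisible hull. *)
Definition hull_comp e (x : F) : Prop :=
  x = 0 \/ exists2 g, e = to_hull g & gf_comp g x.

(* The summand of grade e of F[X]^(lambda): the coefficient of X^i has grade
   e - i lambda. *)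
Definition poly_comp lambda e p : Prop :=
  forall i, hull_comp (e - lambda *+ i) p`_i.

(* lambda \in Gamma_F \otimes Q, inside the divisible hull of G *)
Definition in_grade_hull lambda : Prop :=
  exists m g, in_grade_set F g /\ lambda *+ m.+1 = to_hull g.

Definition homogenizable p : Prop :=
  exists2 lambda, in_grade_hull lambda & exists e, poly_comp lambda e p.

End Homogenizable.

(* [irreducible_poly] is not used for {poly F}, F a graded field: it is meant for
   polynomials over a field, whereas F may have nonzero nonunits. *)
Definition invertible (R : comNzRingType) (x : R) : Prop := exists y, x * y = 1.

Definition irreducible_elt (R : comNzRingType) (x : R) : Prop :=
  [/\ x != 0, ~ invertible x
    & forall y z, x = y * z -> invertible y \/ invertible z].

Definition splits (R : comNzRingType) (p : {poly R}) : Prop :=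
  exists2 s : seq {poly R}, all (fun q : {poly R} => size q == 2) s
    & p = \prod_(q <- s) q.

(* Being algebraic is part of normality. *)
Definition normal_gradedExt (G : oagType) (F L : gradedField G)
    (iota : gradedExt F L) : Prop :=
  (forall a : L, exists2 p : {poly F}, p != 0 & root (map_poly iota p) a) /\
  forall p : {poly F}, homogenizable p -> irreducible_elt p ->
    (exists a : L, root (map_poly iota p) a) -> splits (map_poly iota p).

(* A fieldExtType is finite dimensional, hence algebraic. *)
Definition normal_fieldExt (E : fieldType) (M : fieldExtType E) : Prop :=
  forall p : {poly E}, irreducible_poly p ->
    (exists a : M, root (map_poly (in_alg M) p) a) ->
    splits (map_poly (in_alg M) p).

Section AssocGradedField.
Variables (G : oagType) (E : fieldType) (v : valuation G E).
Implicit Types (f h : assoc_gr v).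

Definition ge_comp (g : G) f : Prop := forall d, d != g -> f d = 0.

Lemma ge_comp0 g : ge_comp g 0.
Proof. by []. Qed.

Lemma ge_compB g f h : ge_comp g f -> ge_comp g h -> ge_comp g (f - h).
Proof. by move=> gf gh d dg; rewrite /= gf ?gh // subr0. Qed.

Lemma ge_comp_hom g x : ge_comp g (gr_hom v g x).
Proof. by move=> d /negPf /= ->. Qed.

Lemma ge_compP g f : ge_comp g f -> f = gr_hom v g (gr_repr (f g)).
Proof.
move=> gf; apply: assoc_grP => d /=.
by have [->|/gf//] := eqVneq d g; rewrite gr_reprK.
Qed.

Lemma ge_compM g d f h : ge_comp g f -> ge_comp d h -> ge_comp (g + d) (f * h).
Proof.
move=> /ge_compP-> /ge_compP->.
by rewrite [_ * _]gr_homM ?gr_repr_vge //; apply: ge_comp_hom.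
Qed.

Lemma ge_span f : exists (s : seq G) (c : G -> assoc_gr v),
  [/\ uniq s, forall g, ge_comp g (c g) & f = \sum_(g <- s) c g].
Proof.
exists (gr_supp f), (fun g => gr_hom v g (gr_repr (f g))); split.
- exact: undup_uniq.
- by move=> g; apply: ge_comp_hom.
- by apply: assoc_gr_expand; [apply: undup_uniq|apply: gr_suppP].
Qed.

Lemma ge_indep (s : seq G) (c : G -> assoc_gr v) :
    uniq s -> (forall g, ge_comp g (c g)) -> \sum_(g <- s) c g = 0 ->
  forall g, g \in s -> c g = 0.
Proof.
move=> us cP c0 g gs; apply: assoc_grP => d.
have [->|/cP//] := eqVneq d g.
transitivity ((\sum_(g <- s) c g) g); last by rewrite c0.
rewrite assoc_gr_sumE (bigD1_seq g) //= big1 ?addr0 // => e eg.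
by apply: cP; rewrite eq_sym.
Qed.

Lemma ge_inv g f : ge_comp g f -> f != 0 -> exists h, f * h = 1.
Proof.
move=> /ge_compP; set x := gr_repr _ => ef; rewrite ef => f0.
have x_vgt : x \notin vgt v g by apply: contraNN f0 => /gr_hom_eq0->.
have x_vge : x \in vge v g by apply: gr_repr_vge.
have x0 := vge_neq0 x_vgt; have vx := vgtN_val x_vge x_vgt.
have vxV : v x^-1 = - g.
  by apply: (addrI (v x)); rewrite -valM ?invr_eq0 // divff // val1 vx subrr.
exists (gr_hom v (- g) x^-1).
by rewrite [LHS]gr_homM // -?vxV ?vge_val // vxV subrr divff.
Qed.

Definition assoc_gradedField : gradedField G :=
  @GradedField G (assoc_gr v) ge_comp ge_comp0 ge_compB (@ge_comp_hom 0 1)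
    ge_compM ge_span ge_indep ge_inv.

End AssocGradedField.

(* The canonical embedding GE -> GM, x + E^{>g} |-> x + M^{>g} *)

Definition val_extends (G : oagType) (E : fieldType) (M : fieldExtType E)
    (v : valuation G E) (w : valuation G M) : Prop :=
  forall x : E, x != 0 -> w x%:A = v x.

Section AssocGradedExt.
Variables (G : oagType) (E : fieldType) (M : fieldExtType E).
Variables (v : valuation G E) (w : valuation G M) (vw : val_extends v w).

Lemma vge_ext g (x : E) : (x%:A \in vge w g) = (x \in vge v g).
Proof.
by rewrite !unfold_in scaler_eq0 oner_eq0 orbF; have [//|/vw->] := eqVneq x 0.
Qed.

Lemma vgt_ext g (x : E) : (x%:A \in vgt w g) = (x \in vgt v g).
Proof.
by rewrite !unfold_in scaler_eq0 oner_eq0 orbF; have [//|/vw->] := eqVneq x 0.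
Qed.

Fact gr_map_fin (f : assoc_gr v) :
  exists s : seq G, forall g, gr_class w g (gr_repr (f g))%:A != 0 -> g \in s.
Proof.
have [s sP] := gr_fin f; exists s => g; rewrite gr_class_eq0 ?vge_ext ?gr_repr_vge //.
by rewrite vgt_ext => fg; apply/sP; apply: contra fg => /eqP/gr_repr_eq0.
Qed.

Definition gr_map (f : assoc_gr v) : assoc_gr w := AssocGr (gr_map_fin f).

Lemma gr_map_hom g x : x \in vge v g -> gr_map (gr_hom v g x) = gr_hom w g x%:A.
Proof.
move=> gx; apply: assoc_grP => d /=; case: eqP => [->|_].
  apply/eqP; rewrite gr_class_eq ?vge_ext ?gr_repr_vge //.
  by rewrite -scalerBl vgt_ext gr_reprB_class.
apply/eqP; rewrite gr_class_eq0 ?vge_ext ?gr_repr_vge // vgt_ext.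
exact: gr_repr_eq0.
Qed.

Fact gr_map_zmod : zmod_morphism gr_map.
Proof.
move=> f h; apply: assoc_grP => g /=.
apply: (addIr (gr_map h g)); rewrite subrK /= -gr_classD ?vge_ext ?gr_repr_vge //.
have fhg : gr_repr (f g - h g) + gr_repr (h g) \in vge v g.
  by rewrite rpredD ?gr_repr_vge.
apply/eqP; rewrite -scalerDl gr_class_eq ?vge_ext ?gr_repr_vge //.
rewrite -scalerBl vgt_ext -gr_class_eq ?gr_repr_vge //.
by rewrite gr_classD ?gr_repr_vge // !gr_reprK subrK.
Qed.

HB.instance Definition _ :=
  GRing.isZmodMorphism.Build (assoc_gr v) (assoc_gr w) gr_map gr_map_zmod.

Fact gr_map_monoid : monoid_morphism gr_map.
Proof.
split; first by rewrite [LHS]gr_map_hom ?vge1 // scale1r.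
have mapD f h : gr_map (f + h) = gr_map f + gr_map h by apply: raddfD.
have map0 : gr_map 0 = 0 by apply: raddf0.
move=> f h; elim/assoc_gr_ind: f => [|f1 f2 e1 e2|b x bx].
- by rewrite mul0r !map0 mul0r.
- by rewrite mulrDl !mapD e1 e2 -mulrDl.
elim/assoc_gr_ind: h => [|h1 h2 e1 e2|c y cy].
- by rewrite mulr0 !map0 mulr0.
- by rewrite mulrDr !mapD e1 e2 -mulrDr.
rewrite [gr_hom _ _ _ * _]gr_homM // !gr_map_hom ?vgeM //.
by rewrite [RHS]gr_homM ?vge_ext // -scalerAl mul1r scalerA.
Qed.

HB.instance Definition _ :=
  GRing.isMonoidMorphism.Build (assoc_gr v) (assoc_gr w) gr_map gr_map_monoid.

Fact gr_map_inj : injective gr_map.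
Proof.
apply: raddf_inj => f f0; apply: assoc_grP => g.
apply/eqP; rewrite -[f g]gr_reprK gr_class_eq0 ?gr_repr_vge //.
rewrite -vgt_ext -gr_class_eq0 ?vge_ext ?gr_repr_vge //.
by rewrite -[gr_class _ _ _]/(gr_map f g) f0.
Qed.

Fact gr_map_comp g (f : assoc_gr v) : ge_comp g f -> ge_comp g (gr_map f).
Proof.
by move=> /ge_compP->; rewrite gr_map_hom ?gr_repr_vge //; apply: ge_comp_hom.
Qed.

Lemma gr_map_tilde x : gr_map (tilde v x) = tilde w x%:A.
Proof.
have tilde0 K (u : valuation G K) : tilde u 0 = 0.
  by apply: gr_hom_eq0; rewrite unfold_in eqxx.
have [->|x0] := eqVneq x 0; first by rewrite scale0r !tilde0 raddf0.
by rewrite gr_map_hom ?vge_val // /tilde vw.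
Qed.

Definition assoc_gradedExt :
    gradedExt (assoc_gradedField v) (assoc_gradedField w) :=
  @GradedExt G (assoc_gradedField v) (assoc_gradedField w)
    gr_map gr_map_inj gr_map_comp.

End AssocGradedExt.

(* Main.v *)
Require Import Defs.
From HB Require Import structures.
From mathcomp Require Import all_boot all_order all_algebra all_field.
From mathcomp Require Import boolp zify.

Set Implicit Arguments.
Unset Strict Implicit.
Unset Printing Implicit Defensive.

Import Order.TTheory GRing.Theory Num.Theory.
Local Open Scope ring_scope.
Local Open Scope quotient_scope.

(** Give X the grade g.  A polynomial q over a valued field whose coefficients
satisfy v(q_i) >= d - ig has an initial form of grade d: the coefficient of X^i
is the class of q_i in grade d - ig.  Initial forms are multiplicative
([init_formM]), commute with the extension of scalars from E to M
([map_init_form]), and send a root x with w(x) >= g to a root, the class of x in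
grade g ([root_init_form]).  For a suitable d, the initial form of a linear
polynomial is a nonzero constant or a nonzero constant times a monic linear
polynomial ([init_form_linear]).  Let x be in M and f its minimal polynomial over
E.  As M is normal, f splits over M; hence f has an initial form h over GE that is
homogeneous, kills the class of x, and becomes a product of linear factors over GM
([homog_annihilator]).  The conjugates of x may have values different from w(x);
they contribute a factor X or a constant to h, which does no harm.

Algebraicity: the leading coefficient of h is homogeneous, hence a unit, so
homogeneous elements of GM are integral over GE, and integral elements form a ring.

Splitting: let p in GE[X] be irreducible, homogeneous when X has grade lambda, with
a root a in GM.  If a = 0, then p is a unit times X.  Otherwise the term l of
lowest grade g of a is again a root of p, and g = lambda ([lowest_root]).
Indeed, let c_i, of grade gamma_i, be the nonzero coefficients of p.  The lowest
grade gamma_i + ig of c_i a^i is constant in i if g = lambda, and injective in i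
otherwise; in the second case the smallest one is reached once, and its term
cannot cancel.  So p has a root that is the class of some x in M, with the
grade that makes p and h homogeneous for the same grade of X.  Euclidean division
works for homogeneous polynomials because their leading coefficients are units;
therefore p, being irreducible, divides h ([irreducible_homog_dvd]).  Finally GM is
a domain, and over a domain a divisor of a product of linear factors is one
([linear_product_factor]). *)

(** * Products of linear factors *)

(** The rings [assoc_gr] carry a [comNzRingType] structure only, with no chosen
inverse, so that integrality is expressed as a property instead of an
[idomainType] structure. *)
Definition no_zero_divisors (R : comNzRingType) : Prop :=
  forall x y : R, x * y = 0 -> x = 0 \/ y = 0.

Definition linear_product (R : comNzRingType) (p : {poly R}) : Prop :=
  exists c (s : seq R), c != 0 /\ p = c%:P * \prod_(r <- s) ('X - r%:P).

Section LinearProduct.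
Variable R : comNzRingType.
Hypothesis domR : no_zero_divisors R.
Implicit Types p q : {poly R}.

Lemma linear_productM p q :
  linear_product p -> linear_product q -> linear_product (p * q).
Proof.
move=> [c [s [c0 ->]]] [d [t [d0 ->]]]; exists (c * d), (s ++ t); split.
  by apply/eqP => /domR[]/eqP; apply/negP.
by rewrite big_cat polyCM /= mulrACA.
Qed.

Lemma linear_product_neq0 p : linear_product p -> p != 0.
Proof.
move=> [c [s [c0 ->]]]; have mon := monic_prod_XsubC s xpredT id.
by rewrite -size_poly_eq0 size_Mmonic ?polyC_eq0 // size_prod_XsubC size_polyC c0.
Qed.

(** Each root r of p q is a root of p or of q; its factor X - r is cancelled, and
the induction goes on with one linear factor less. *)
Lemma linear_product_factor p q : linear_product (p * q) -> linear_product p.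
Proof.
move=> [c [s [c0]]]; elim: s p q => [|r s IHs] p q.
  rewrite big_nil mulr1 => pq.
  have pq0 : p * q != 0 by rewrite pq polyC_eq0.
  have lp0 : lead_coef p != 0.
    by rewrite lead_coef_eq0; apply: contraNneq pq0 => ->; rewrite mul0r.
  have lq0 : lead_coef q != 0.
    by rewrite lead_coef_eq0; apply: contraNneq pq0 => ->; rewrite mulr0.
  have : size (p * q) = 1%N by rewrite pq size_polyC c0.
  rewrite size_proper_mul; last by apply/eqP => /domR[]/eqP; apply/negP.
  move: lp0 lq0; rewrite !lead_coef_eq0 -!size_poly_gt0 => sp sq spq.
  have /size_poly1P[d d0 ->] : size p == 1%N by apply/eqP; lia.
  by exists d, [::]; rewrite big_nil mulr1.
rewrite big_cons mulrCA [_ * (c%:P * _)]mulrC => pq.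
have cancelX : GRing.rreg ('X - r%:P) by apply/monic_rreg/monicXsubC.
have pqr : p.[r] * q.[r] = 0 by rewrite -hornerM pq hornerM hornerXsubC subrr mulr0.
have [/rootP|/rootP] := domR pqr => /factor_theorem[t et].
  have /IHs[d [u [d0 et']]] : t * q = c%:P * \prod_(j <- s) ('X - j%:P).
    by apply: cancelX; rewrite -pq et mulrAC.
  by exists d, (r :: u); split=> //; rewrite et et' big_cons [RHS]mulrCA mulrC.
by apply: (IHs p t); apply: cancelX; rewrite -pq et mulrA.
Qed.

Lemma linear_product_splits p r : linear_product p -> root p r -> splits p.
Proof.
move=> [c [[|a s] [c0 ->]]].
  by rewrite big_nil mulr1 rootC (negPf c0).
move=> _; exists ((c%:P * ('X - a%:P)) :: [seq 'X - b%:P | b <- s]).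
  rewrite /= size_Mmonic ?monicXsubC ?polyC_eq0 // size_polyC c0 size_XsubC /=.
  by apply/allP => _ /mapP[b _ ->]; rewrite size_XsubC.
by rewrite !big_cons big_map mulrA.
Qed.

End LinearProduct.

(** * Homogeneous polynomials over a graded field *)

Section Homogeneous.
Variables (G : oagType) (F : gradedField G).
Implicit Types (g d : G) (p q h m : {poly F}).

Definition homog g d p : Prop := forall i, gf_comp (d - g *+ i) p`_i.

Lemma gradeD g d e i j :
  (d - g *+ i) + (e - g *+ j) = (d + e) - g *+ (i + j).
Proof. by rewrite addrACA -opprD -mulrnDr. Qed.

Lemma homog_lead_inv g d p : homog g d p -> p != 0 -> invertible (lead_coef p).
Proof. by move=> hp p0; apply: gf_inv (hp _) _; rewrite lead_coef_eq0. Qed.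

(** When X has a grade in G, a nonzero homogeneous polynomial has its total grade
in G as well: that grade is read off any nonzero coefficient. *)
Lemma poly_comp_homog g e p :
  poly_comp (to_hull g) e p -> p != 0 -> exists d, homog g d p.
Proof.
move=> hp p0; have nz : lead_coef p != 0 by rewrite lead_coef_eq0.
have to_hullMn n : to_hull (g *+ n) = to_hull g *+ n.
  by rewrite [to_hull g *+ n]hull_mulrn.
case: (hp (size p).-1) => [lp0|[d0 ed0 _]]; first by rewrite lead_coefE lp0 eqxx in nz.
have {ed0} ee : e = to_hull (d0 + g *+ (size p).-1).
  by rewrite to_hullD -ed0 to_hullMn subrK.
exists (d0 + g *+ (size p).-1) => i; case: (hp i) => [->|[d]]; first exact: gf_comp0.
rewrite ee -to_hullMn => ed; suff <- : d = d0 + g *+ (size p).-1 - g *+ i by [].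
by apply: to_hull_inj; apply: (addIr (to_hull (g *+ i))); rewrite -ed -to_hullD !subrK.
Qed.

Section CommonRoot.
Variables (R : comNzRingType) (phi : {rmorphism F -> R}) (a : R).
Local Notation vanishes p := (root (map_poly phi p) a).

(** Euclidean division, one step at a time: the leading coefficient of m is a unit,
and cancelling the leading term of h by a multiple of m keeps homogeneity. *)
Lemma min_homog_dvd g e m : homog g e m -> m != 0 -> vanishes m ->
    (forall d h, homog g d h -> vanishes h -> h != 0 -> (size m <= size h)%N) ->
  forall d h, homog g d h -> vanishes h -> exists q, h = q * m.
Proof.
move=> hm m0 ma m_min d h; move: {2}(size h) (leqnn (size h)) => n.
elim: n d h => [|n IHn] d h sh hh ha.
  by exists 0; apply/eqP; rewrite mul0r -size_poly_eq0 -leqn0.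
have [->|h0] := eqVneq h 0; first by exists 0; rewrite mul0r.
have smh := m_min d h hh ha h0.
have [u mu1] := homog_lead_inv hm m0.
have sm : (0 < size m)%N by rewrite size_poly_gt0.
pose k := (size h - size m)%N.
(* Multiplying h by the leading coefficient of m, rather than dividing by it,
   keeps r homogeneous without knowing the grade of an inverse. *)
pose r := lead_coef m *: h - lead_coef h *: ('X^k * m).
have hr : homog g (e + d - g *+ (size m).-1) r.
  move=> i; rewrite coefB !coefZ coefXnM; apply: gf_compB.
    by have := gf_compM (hm (size m).-1) (hh i); rewrite gradeD mulrnDr opprD addrA.
  case: ltnP => [_|ki]; first by rewrite mulr0; apply: gf_comp0.
  have := gf_compM (hh (size h).-1) (hm (i - k)%N).
  rewrite gradeD [d + e]addrC -[_ - g *+ i]addrA -opprD -mulrnDr.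
  by congr (gf_comp (_ - g *+ _) _); rewrite /k in ki *; lia.
have ra : vanishes r.
  rewrite rmorphB /= !map_polyZ rmorphM /= rootE hornerD hornerN !hornerZ hornerM.
  by rewrite (rootP ha) (rootP ma) !mulr0 subr0.
have sr : (size r <= n)%N.
  apply/leq_sizeP => j nj; rewrite coefB !coefZ coefXnM.
  case: ltnP => jk; first by move: jk; rewrite /k; lia.
  have [ej|ne] := eqVneq j (size h).-1.
    rewrite ej -lead_coefE (_ : (_ - k)%N = (size m).-1) -?lead_coefE.
      by rewrite mulrC subrr.
    by rewrite /k; lia.
  have [hj mj] : (size h <= j)%N /\ (size m <= j - k)%N.
    by move/eqP: ne => ne; split; rewrite /k in jk *; lia.
  by rewrite !nth_default // !mulr0 subr0.
have [q rq] := IHn _ _ sr hr ra.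
exists (u *: (q + lead_coef h *: 'X^k)).
rewrite -scalerAl mulrDl -rq -scalerAl /r subrK scalerA [u * _]mulrC mu1.
by rewrite scale1r.
Qed.

(** The homogeneous polynomials that vanish at a are the homogeneous multiples of one
of least degree, which is associated to p since p is irreducible. *)
Lemma irreducible_homog_dvd g d e p h :
    homog g d p -> irreducible_elt p -> vanishes p ->
    homog g e h -> vanishes h -> exists q, h = p * q.
Proof.
move=> hp [p0 _ p_irr] pa hh ha.
pose P := [pred n | `[< exists c q, [/\ homog g c q, vanishes q, q != 0 & size q = n] >]].
have exP : exists n, P n by exists (size p); apply/asboolP; exists d, p.
case: (ex_minnP exP) => n /asboolP[c [m [hm ma m0 sm]]] n_min.
have m_min b q : homog g b q -> vanishes q -> q != 0 -> (size m <= size q)%N.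
  by move=> hq qa q0; rewrite sm; apply: n_min; apply/asboolP; exists b, q.
have [q pq] := min_homog_dvd hm m0 ma m_min hp pa.
have [t ht] := min_homog_dvd hm m0 ma m_min hh ha.
case: (p_irr q m pq) => [[y qy]|[y my]].
  by exists (t * y); rewrite ht pq [t * y]mulrC mulrACA qy mul1r mulrC.
have : (map_poly phi (m * y)).[a] = 0 by rewrite rmorphM /= hornerM (rootP ma) mul0r.
by rewrite my rmorph1 hornerC => /eqP; rewrite oner_eq0.
Qed.

End CommonRoot.
End Homogeneous.

(** * Lowest terms in an associated graded field *)

Lemma oag_ltNge (G : oagType) (x y : G) : (x < y) = ~~ (y <= x).
Proof. by case: (comparable_ltgtP (oag_total x y)). Qed.

Lemma oag_seq_min (G : oagType) (s : seq G) :
  s != [::] -> exists2 m, m \in s & forall x, x \in s -> m <= x.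
Proof.
case: s => // x s _; elim: s x => [|y s IHs] x.
  by exists x => [|z]; rewrite inE // => /eqP->.
have [m ms m_min] := IHs y; have /orP[xm|mx] := oag_total x m.
  exists x => [|z]; rewrite inE ?eqxx // => /orP[/eqP->//|/m_min].
  exact: le_trans.
exists m => [|z]; first by rewrite inE ms orbT.
by rewrite inE => /orP[/eqP->//|/m_min].
Qed.

Lemma hull_mulrn_eq0 (G : oagType) (x : divhull G) n : x *+ n.+1 = 0 -> x = 0.
Proof.
elim/quotW: x => -[a m].
rewrite -[0](mulr0n (\pi_(divhull G) (a, m))) !hull_mulrn => /eqP.
rewrite piE /dh_eq /= mulr0n mul0rn -mulrnA mulnC mulrnA => /eqP.
by move=> /oag_mulrn_eq0/oag_mulrn_eq0->.
Qed.

Lemma hull_mulrnI (G : oagType) (x : divhull G) i j : x *+ i = x *+ j -> x = 0 \/ i = j.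
Proof.
wlog le_ij : i j / (i <= j)%N.
  by move=> H; have /orP[/H//|/H{}H /esym/H[]] := leq_total i j; auto.
rewrite -(subnK le_ij) mulrnDr -{1}[x *+ i]add0r => /addIr/esym.
by case: (j - i)%N => [|n]; [right | move/hull_mulrn_eq0; left].
Qed.

Section LowestTerm.
Variables (G : oagType) (K : fieldType) (w : valuation G K).
Implicit Types (g d b c : G) (f h l : assoc_gr w).

Definition from_grade d f : Prop := forall g, g < d -> f g = 0.
Definition above_grade d f : Prop := forall g, g <= d -> f g = 0.

Lemma assoc_grM_eq0 f h g :
  (forall b c, b + c = g -> f b = 0 \/ h c = 0) -> (f * h) g = 0.
Proof.
move=> fh0; rewrite [f * h]/(assoc_grM f h) assoc_gr_sumE big1 // => b _.
rewrite assoc_gr_sumE big1 // => c _ /=; case: eqP => // /esym bc.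
rewrite -bc; apply/eqP; rewrite gr_class_eq0 ?vgeM ?gr_repr_vge //.
case: (fh0 b c bc) => /gr_repr_eq0 z0; first by apply: vgtM; rewrite ?gr_repr_vge.
by rewrite mulrC addrC; apply: vgtM; rewrite ?gr_repr_vge.
Qed.

Lemma above_gradeM b c f h :
  above_grade b f -> from_grade c h -> above_grade (b + c) (f * h).
Proof.
move=> bf ch g gbc; apply: assoc_grM_eq0 => b' c' bc'.
have [/bf|] := boolP (b' <= b); first by left.
rewrite -oag_ltNge => bb'; right; apply: ch; move: gbc; rewrite -bc'.
by apply: contraTT; rewrite -oag_ltNge oag_ltNge negbK => cc'; apply: oag_lt_leD.
Qed.

Lemma above_gradeD d f h : above_grade d f -> above_grade d h -> above_grade d (f + h).
Proof. by move=> df dh g gd; rewrite /= df ?dh // addr0. Qed.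

Lemma ge_comp_from d f : ge_comp d f -> from_grade d f.
Proof. by move=> df g gd; apply: df; rewrite lt_eqF. Qed.

Lemma ge_comp_eq0 d f : ge_comp d f -> f d = 0 -> f = 0.
Proof. by move=> df fd0; apply: assoc_grP => g; have [->|/df] := eqVneq g d. Qed.

Definition lowest_term g f l : Prop :=
  [/\ ge_comp g l, l != 0, from_grade g f & above_grade g (f - l)].

Lemma lowest_term_ex f : f != 0 -> exists g l, lowest_term g f l.
Proof.
move=> f0; have [|g] := @oag_seq_min G [seq g <- gr_supp f | f g != 0].
  apply: contraNneq f0 => s0; apply/eqP/assoc_grP => g; apply/eqP.
  apply: contraT => fg; have := gr_suppP fg.
  by move=> gs; have := mem_filter (fun g => f g != 0) g (gr_supp f); rewrite s0 fg gs.
rewrite mem_filter => /andP[fg _] g_min.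
have fromf : from_grade g f.
  move=> d dg; apply/eqP; apply: contraTT dg => fd; rewrite oag_ltNge negbK.
  by apply: g_min; rewrite mem_filter fd gr_suppP.
exists g, (gr_hom w g (gr_repr (f g))); split=> //; first exact: ge_comp_hom.
  by apply: contraNneq fg => l0; rewrite -[f g]gr_reprK -gr_homE l0.
move=> d; rewrite le_eqVlt => /orP[/eqP->|dg] /=; first by rewrite eqxx gr_reprK subrr.
by rewrite fromf // lt_eqF // subr0.
Qed.

Lemma ge_compM_eq0 g f h : ge_comp g f -> f != 0 -> f * h = 0 -> h = 0.
Proof.
move=> gf f0 fh; have [y fy] := ge_inv gf f0.
by rewrite -[h]mul1r -fy -mulrA [y * h]mulrC mulrA fh mul0r.
Qed.

(** The product of the lowest terms is the lowest term of the product: it is nonzero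
because nonzero homogeneous elements are invertible. *)
Lemma assoc_gr_domain : no_zero_divisors (assoc_gr w).
Proof.
move=> f h fh; have [->|f0] := eqVneq f 0; first by left.
have [->|h0] := eqVneq h 0; first by right.
have [b [l [bl l0 bf fl]]] := lowest_term_ex f0.
have [c [k [ck k0 ch hk]]] := lowest_term_ex h0.
have : above_grade (b + c) (f * h - l * k).
  rewrite -[f * h](subrK (l * h)) -addrA -mulrBl -mulrBr; apply: above_gradeD.
    exact: above_gradeM.
  by rewrite addrC mulrC; apply: above_gradeM => //; apply: ge_comp_from.
rewrite fh sub0r => /(_ _ (lexx _)) /= /eqP; rewrite oppr_eq0 => /eqP.
move/(ge_comp_eq0 (ge_compM bl ck))/(ge_compM_eq0 bl l0) => ek.
by rewrite ek eqxx in k0.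
Qed.

Lemma ge_compX g l n : ge_comp g l -> ge_comp (g *+ n) (l ^+ n).
Proof.
move=> gl; elim: n => [|n IHn]; first exact: ge_comp_hom.
by rewrite mulrS exprS; apply: ge_compM.
Qed.

Lemma lowest_termX g f l n :
  lowest_term g f l -> above_grade (g *+ n) (f ^+ n - l ^+ n).
Proof.
move=> [gl l0 gf fl]; elim: n => [|n IHn]; first by rewrite subrr.
rewrite !exprS -[f * _](subrK (f * l ^+ n)) -addrA -mulrBr -mulrBl mulrS.
apply: above_gradeD; last by apply/above_gradeM/ge_comp_from/ge_compX.
by rewrite addrC mulrC; apply: above_gradeM.
Qed.

Lemma ge_comp_sum (I : Type) (s : seq I) (P : pred I) (T : I -> assoc_gr w) d :
  (forall i, P i -> ge_comp d (T i)) -> ge_comp d (\sum_(i <- s | P i) T i).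
Proof.
move=> dT g gd; rewrite -big_filter assoc_gr_sumE big_filter big1 // => i Pi.
exact: dT.
Qed.

(** The lowest grade D i of p_i f^i is compared in the divisible hull, where
D i = e + i (g - lambda): for p_i nonzero, these
grades all agree or are pairwise distinct. *)
Lemma lowest_root (p : {poly assoc_gr w}) (lambda e : divhull G) f :
    @poly_comp G (assoc_gradedField w) lambda e p -> p != 0 -> f != 0 -> root p f ->
  exists g l, [/\ to_hull g = lambda, ge_comp g l & root p l].
Proof.
move=> hp p0 f0 /rootP pf; have [g [l low]] := lowest_term_ex f0.
have [gl l0 gf fl] := low; exists g, l.
have /choice[gam gamP] : forall i, exists d, p`_i != 0 ->
    e - lambda *+ i = to_hull d /\ ge_comp d p`_i.
  move=> i; case: (hp i) => [->|[d ed pd]]; first by exists 0; rewrite eqxx.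
  by exists d.
pose T i := p`_i * l ^+ i; pose D i := gam i + g *+ i.
have TD i : ge_comp (D i) (T i).
  have [pi0|/gamP[_ pi]] := eqVneq p`_i 0; first by rewrite /T pi0 mul0r.
  exact/ge_compM/ge_compX.
have hullD i : p`_i != 0 -> to_hull (D i) = e + (to_hull g - lambda) *+ i.
  move=> /gamP[ed _]; rewrite to_hullD -ed -addrA [- _ + _]addrC mulrnBl.
  by rewrite [to_hull g *+ i]hull_mulrn.
have [|_ /mapP[i0 i0P ->] d_min] :=
    @oag_seq_min G [seq D i | i <- iota 0 (size p) & p`_i != 0].
  apply/eqP => s0; have : D (size p).-1 \in [seq D i | i <- iota 0 (size p) & p`_i != 0].
    apply: map_f; rewrite mem_filter -lead_coefE lead_coef_eq0 p0 mem_iota /=.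
    by rewrite prednK ?leqnn // size_poly_gt0.
  by rewrite s0.
move: i0P; rewrite mem_filter => /andP[pi0 i0s].
(* In the smallest grade D i0, each p_i f^i has the same component as T i. *)
have sumT0 : (\sum_(i < size p) T i) (D i0) = 0.
  have -> : \sum_(i < size p) T i = - \sum_(i < size p) p`_i * (f ^+ i - l ^+ i).
    rewrite -[LHS]subr0 -[X in _ - X]pf horner_coef -sumrB -sumrN.
    by apply: eq_bigr => i _; rewrite /T -mulrBr -mulrN opprB.
  apply/eqP; rewrite /= oppr_eq0 assoc_gr_sumE; apply/eqP/big1 => i _.
  have [->|pi] := eqVneq p`_i 0; first by rewrite mul0r.
  have [_ gpi] := gamP _ pi.
  suff : above_grade (D i) (p`_i * (f ^+ i - l ^+ i)).
    by apply; apply: d_min; apply: map_f; rewrite mem_filter pi mem_iota /= ltn_ord.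
  rewrite mulrC [D i]addrC.
  apply: above_gradeM; first exact: lowest_termX low.
  exact: ge_comp_from.
have [eg|ne] := eqVneq (to_hull g) lambda.
  (* All the nonzero T i have grade D i0, so their sum, which is p(l), vanishes. *)
  split=> //; apply/rootP; rewrite horner_coef.
  apply: (@ge_comp_eq0 (D i0)) sumT0; apply: ge_comp_sum => i _.
  rewrite -[X in ge_comp _ X]/(T i); have [pi|pi] := eqVneq p`_i 0.
    by rewrite /T pi mul0r.
  rewrite (_ : D i0 = D i); first exact: TD.
  by apply: to_hull_inj; rewrite !hullD // eg subrr !mul0rn.
(* Among the nonzero T i, only T i0 has grade D i0, so it would vanish. *)
have /eqP : T i0 = 0.
  apply: (ge_comp_eq0 (TD i0)).
  move: sumT0; rewrite assoc_gr_sumE.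
  have lti0 : (i0 < size p)%N by move: i0s; rewrite mem_iota.
  rewrite (bigD1 (Ordinal lti0)) //= big1 ?addr0 // => i.
  rewrite -val_eqE /= => ne_i; have [pi|pi] := eqVneq p`_i 0.
    by rewrite /T pi mul0r.
  apply: TD; apply: contraNneq ne_i => eD.
  have := hullD _ pi; rewrite -eD hullD // => /addrI/hull_mulrnI[/eqP|->//].
  by rewrite subr_eq0 (negPf ne).
have ln0 n : l ^+ n <> 0.
  elim: n => [|n IHn]; first by apply/eqP/oner_neq0.
  by rewrite exprS => /(ge_compM_eq0 gl l0).
by move/eqP/assoc_gr_domain => [/eqP|/ln0//]; rewrite (negPf pi0).
Qed.

End LowestTerm.

(** * Initial forms *)

Section InitialForm.
Variables (G : oagType) (K : fieldType) (u : valuation G K).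
Implicit Types (g d e : G) (q r : {poly K}) (x : K).

(** The value of q under the Gauss extension of u that gives X the value g is at
least d. *)
Definition gauss_ge g d q : Prop := forall i, q`_i \in vge u (d - g *+ i).

Definition init_form g d q : {poly assoc_gr u} :=
  \poly_(i < size q) gr_hom u (d - g *+ i) q`_i.

Lemma coef_init_form g d q i : (init_form g d q)`_i = gr_hom u (d - g *+ i) q`_i.
Proof.
rewrite coef_poly; case: ltnP => // /leq_sizeP->//.
by rewrite gr_hom_eq0 ?rpred0.
Qed.

Lemma homog_init_form g d q : @homog G (assoc_gradedField u) g d (init_form g d q).
Proof. by move=> i; rewrite coef_init_form; apply: ge_comp_hom. Qed.

Lemma gr_hom_sum g n (F : nat -> K) : (forall i, (i < n)%N -> F i \in vge u g) ->
  gr_hom u g (\sum_(i < n) F i) = \sum_(i < n) gr_hom u g (F i).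
Proof.
elim: n => [|n IHn] gF; first by rewrite !big_ord0 gr_hom_eq0 ?rpred0.
have gFn i : (i < n)%N -> F i \in vge u g by move/ltnW/gF.
rewrite !big_ord_recr /= gr_homD ?IHn ?gF //.
by apply: rpred_sum => i _; apply: gFn.
Qed.

Lemma gauss_geM g d e q r :
  gauss_ge g d q -> gauss_ge g e r -> gauss_ge g (d + e) (q * r).
Proof.
move=> dq er i; rewrite coefM rpred_sum // => j _.
have -> : d + e - g *+ i = (d - g *+ j) + (e - g *+ (i - j)).
  by rewrite gradeD subnKC // -ltnS.
exact: vgeM.
Qed.

(** Multiplication of classes is multiplication of representatives, so the two
convolution products agree term by term. *)
Lemma init_formM g d e q r : gauss_ge g d q -> gauss_ge g e r ->
  init_form g (d + e) (q * r) = init_form g d q * init_form g e r.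
Proof.
move=> dq er; apply/polyP => i; rewrite coef_init_form !coefM.
have grade j : (j < i.+1)%N -> d + e - g *+ i = (d - g *+ j) + (e - g *+ (i - j)).
  by move=> ji; rewrite gradeD subnKC // -ltnS.
rewrite (gr_hom_sum (F := fun j => q`_j * r`_(i - j))); last first.
  by move=> j ji; rewrite (grade j ji); apply: vgeM.
apply: eq_bigr => j _; rewrite !coef_init_form (grade j) ?ltn_ord //.
by rewrite [RHS]gr_homM.
Qed.

Lemma vgeX g x n : x \in vge u g -> x ^+ n \in vge u (g *+ n).
Proof.
by move=> gx; elim: n => [|n IHn]; [apply: vge1 | rewrite exprS mulrS vgeM].
Qed.

Lemma gr_homX g x n : x \in vge u g -> gr_hom u (g *+ n) (x ^+ n) = gr_hom u g x ^+ n.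
Proof.
move=> gx; elim: n => [//|n IHn].
by rewrite exprS mulrS exprS -IHn [RHS]gr_homM // vgeX.
Qed.

(** Each term of the initial form at the class of x is the class of q_i x^i in grade
d, and these classes add up to that of q(x). *)
Lemma root_init_form g d q x : gauss_ge g d q -> x \in vge u g -> root q x ->
  root (init_form g d q) (gr_hom u g x).
Proof.
move=> dq gx /rootP qx; apply/rootP.
rewrite (@horner_coef_wide _ (size q)) ?size_poly //.
have dE i : d = (d - g *+ i) + g *+ i by rewrite subrK.
have dqx i : q`_i * x ^+ i \in vge u d by rewrite (dE i) vgeM ?vgeX.
transitivity (gr_hom u d q.[x]); last by rewrite qx gr_hom_eq0 ?rpred0.
rewrite horner_coef (gr_hom_sum (F := fun i => q`_i * x ^+ i)) //.
apply: eq_bigr => i _; rewrite coef_init_form -gr_homX // {2}(dE i).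
by rewrite [LHS]gr_homM ?vgeX.
Qed.

(** The grade d is the smaller of u(q_1) + g and u(q_0).  If the root -q_0/q_1 has
value at least g, the initial form keeps its linear term; otherwise only the
constant term survives. *)
Lemma init_form_linear g q : size q = 2%N ->
  exists2 d, gauss_ge g d q & linear_product (init_form g d q).
Proof.
move=> sq; have q1 : q`_1 != 0.
  by rewrite -[1%N]/(2.-1) -sq -lead_coefE lead_coef_eq0 -size_poly_gt0 sq.
have qi i : q`_i.+2 = 0 by rewrite nth_default ?sq.
have gauss d : q`_0 \in vge u d -> q`_1 \in vge u (d - g) -> gauss_ge g d q.
  move=> d0 d1 [|[|i]]; rewrite ?qi ?rpred0 ?subr0 ?mulr1n //.
have initE d : init_form g d q =
    (gr_hom u d q`_0)%:P + (gr_hom u (d - g) q`_1)%:P * 'X.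
  apply/polyP => i; rewrite coef_init_form coefD coefC coefCM coefX.
  case: i => [|[|i]]; rewrite /= ?mulr0 ?mulr1 ?addr0 ?add0r ?subr0 //.
  by rewrite qi gr_hom_eq0 ?rpred0.
have val_hom_neq0 x : x != 0 -> gr_hom u (u x) x != 0.
  by move=> x0; apply: gr_hom_neq0; rewrite ?vge_val // unfold_in (negPf x0) ltxx.
have [d0|d0] := boolP (q`_0 \in vge u (u q`_1 + g)).
  exists (u q`_1 + g); first by apply: gauss; rewrite ?addrK ?vge_val.
  rewrite initE addrK; have c0 := val_hom_neq0 _ q1.
  have [y cy] := ge_inv (@ge_comp_hom _ _ u (u q`_1) q`_1) c0.
  exists (gr_hom u (u q`_1) q`_1), [:: - (y * gr_hom u (u q`_1 + g) q`_0)].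
  split=> //; rewrite big_seq1 mulrBr -polyCM mulrN mulrA cy mul1r polyCN opprK.
  by rewrite addrC.
have [q0 lt_d] : q`_0 != 0 /\ u q`_0 < u q`_1 + g.
  by move: d0; rewrite unfold_in negb_or oag_ltNge => /andP[].
have lt_d' : u q`_0 - g < u q`_1 by rewrite -(oag_ltDr g) subrK.
have d1 : q`_1 \in vgt u (u q`_0 - g) by rewrite unfold_in lt_d' orbT.
exists (u q`_0); first by apply: gauss; rewrite ?vge_val // vgt_vge.
exists (gr_hom u (u q`_0) q`_0), [::]; split; first exact: val_hom_neq0.
by rewrite initE (gr_hom_eq0 d1) polyC0 mul0r addr0 big_nil mulr1.
Qed.

Lemma init_form_splits g q : splits q ->
  exists2 d, gauss_ge g d q & linear_product (init_form g d q).
Proof.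
move=> [s + ->]; elim: s => [_|q1 s IHs /= /andP[/eqP sq1 /IHs[d ds sd]]].
  rewrite big_nil; exists 0 => [i|]; first rewrite coef1.
    by case: i => [|i]; rewrite ?rpred0 // subr0 vge1.
  exists 1, [::]; rewrite oner_neq0 big_nil mulr1; split=> //.
  apply/polyP => i; rewrite coef_init_form coef1 coefC.
  by case: i => [|i] /=; rewrite ?subr0 // gr_hom_eq0 ?rpred0.
have [d1 d1q1 d1s] := init_form_linear g sq1.
rewrite big_cons; exists (d1 + d); first exact: gauss_geM.
by rewrite init_formM //; apply: linear_productM => //; apply: assoc_gr_domain.
Qed.

End InitialForm.

Section Extension.
Variables (G : oagType) (E : fieldType) (M : fieldExtType E).
Variables (v : valuation G E) (w : valuation G M) (vw : val_extends v w).

Lemma minPoly_descent (x : M) : exists2 p : {poly E},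
  irreducible_poly p & map_poly (in_alg M) p = minPoly 1 x.
Proof.
have /polyOver1P[p ep] := minPolyOver 1 x; exists p => //.
split=> [|q sq].
  by rewrite -(size_map_poly (in_alg M)) -ep size_minPoly.
rewrite -(dvdp_map (in_alg M)) -ep => qp.
have q1 : map_poly (in_alg M) q \is a polyOver 1%VS by apply/polyOver1P; exists q.
have /orP[] := minPoly_irr q1 qp; first by rewrite ep eqp_map.
by rewrite -size_poly_eq1 size_map_poly (negPf sq).
Qed.

Lemma map_init_form g d (q : {poly E}) : gauss_ge w g d (map_poly (in_alg M) q) ->
  map_poly (assoc_gradedExt vw) (init_form v g d q) =
  init_form w g d (map_poly (in_alg M) q).
Proof.
move=> dq; apply/polyP => i; rewrite coef_map !coef_init_form coef_map /=.
by rewrite gr_map_hom //; have := dq i; rewrite coef_map (vge_ext vw).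
Qed.

(** The initial form of the minimal polynomial of x, which splits over M by normality. *)
Lemma homog_annihilator (nM : normal_fieldExt M) g (x : M) : x \in vge w g ->
  exists d (h : {poly assoc_gradedField v}),
    [/\ homog g d h, root (map_poly (assoc_gradedExt vw) h) (gr_hom w g x)
      & linear_product (map_poly (assoc_gradedExt vw) h)].
Proof.
move=> gx; have [p p_irr ep] := minPoly_descent x.
have px : root (map_poly (in_alg M) p) x by rewrite ep root_minPoly.
have [|d dp lin] := init_form_splits w g (nM p p_irr _); first by exists x.
exists d, (init_form v g d p); rewrite map_init_form //; split=> //.
  exact: homog_init_form.
exact: root_init_form.
Qed.

(** Integrality, stronger than algebraicity, is proved because it is known to be
stable under sums over any commutative ring. *)
Lemma assoc_gr_integral (nM : normal_fieldExt M) (a : assoc_gr w) :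
  integralOver (assoc_gradedExt vw) a.
Proof.
elim/assoc_gr_ind: a => [|f h|g x gx]; [exact: integral0|exact: integral_add|].
have [d [h [hh hx lin]]] := homog_annihilator nM gx.
have h0 : h != 0.
  have := linear_product_neq0 lin.
  by apply: contraNneq => ->; rewrite rmorph0.
have [y hy] := homog_lead_inv hh h0.
exists (y *: h); last by rewrite map_polyZ rootE hornerZ (rootP hx) mulr0.
rewrite monicE lead_coef_lreg; last first.
  by move=> b c /(congr1 ( *%R (lead_coef h))); rewrite !mulrA hy !mul1r.
by rewrite mulrC hy.
Qed.

End Extension.

Lemma gradedExt_poly_comp (G : oagType) (F L : gradedField G) (iota : gradedExt F L)
    lambda e (p : {poly F}) :
  poly_comp lambda e p -> poly_comp lambda e (map_poly iota p).
Proof.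
move=> hp i; rewrite coef_map /=; case: (hp i) => [->|[d ed pd]].
  by left; exact: rmorph0.
by right; exists d => //; apply: gext_comp.
Qed.

Theorem theorem1p5 (G : oagType) (E : fieldType) (M : fieldExtType E)
    (v : valuation G E) (w : valuation G M) (vw : val_extends v w)
    (nM : normal_fieldExt M) :
  normal_gradedExt (assoc_gradedExt vw).
Proof.
have domM : no_zero_divisors (assoc_gradedField w) by apply: assoc_gr_domain.
split=> [a|p [lambda _ [e hp]] p_irr [a pa]].
  by have [p p_mon pa] := assoc_gr_integral vw nM a; exists p; rewrite // monic_neq0.
(* Over GM, it suffices that p divide a product of linear factors. *)
suff [h [lin [q hq]]] : exists h, linear_product h /\
    exists q, h = map_poly (assoc_gradedExt vw) p * q.
  by rewrite hq in lin; apply: linear_product_splits pa; apply: linear_product_factor lin.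
have [p0 _ p_fact] := p_irr; have inj := @gext_inj _ _ _ (assoc_gradedExt vw).
have [a0|a0] := eqVneq a 0.
  have /factor_theorem[q pq] : root p 0.
    move: pa; rewrite a0 !rootE !horner_coef0 coef_map => /eqP/=.
    by move=> p00; apply/eqP/inj; rewrite rmorph0.
  have lin : linear_product ('X : {poly assoc_gradedField w}).
    by exists 1, [:: 0]; rewrite oner_neq0 big_seq1 subr0 mul1r.
  have [[y qy]|[y Xy]] := p_fact _ _ pq.
    exists 'X; split=> //; exists (map_poly (assoc_gradedExt vw) y).
    by rewrite -rmorphM pq mulrAC qy mul1r polyC0 subr0 /= map_polyX.
  have : ('X - 0%:P : {poly assoc_gradedField v}).[0] * y.[0] = 1.
    by rewrite -hornerM Xy hornerC.
  by rewrite hornerXsubC subrr mul0r => /esym/eqP; rewrite oner_eq0.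
have mp0 : map_poly (assoc_gradedExt vw) p != 0.
  apply: contraNneq p0 => mp0; apply/eqP/(map_inj_poly inj (rmorph0 _)).
  by rewrite mp0 rmorph0.
have mhp := gradedExt_poly_comp (assoc_gradedExt vw) hp.
have [g [l [eg gl pl]]] := lowest_root mhp mp0 a0 pa.
rewrite -eg in hp; have [d dp] := poly_comp_homog hp p0.
rewrite (ge_compP gl) in pl; set x := gr_repr (l g) in pl.
have [d' [h [hh hx lin]]] := homog_annihilator vw nM (gr_repr_vge (l g)).
have [q hq] := irreducible_homog_dvd dp p_irr pl hh hx.
exists (map_poly (assoc_gradedExt vw) h); split=> //.
by exists (map_poly (assoc_gradedExt vw) q); rewrite hq rmorphM.
Qed.
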